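(* Let $X$ be a complex Banach space, let $\mathcal F$ denote either $C_{00}(\mathbb R_+,X)$ or $L^p(\mathbb R_+,X)$ with $1\le p<\infty$, and let $\{U(t,\tau)\}_{t\ge\tau}$ be an exponentially bounded evolution family on $X$. Then $\{U(t,\tau)\}_{t\ge\tau}$ is exponentially stable if and only if the growth bound $\omega_0(E^t)$ of the induced evolution semigroup $\{E^t\}_{t\ge0}$ on $\mathcal F$ is negative.
   Context: $\mathbb R_+=[0,\infty)$. $C_{00}(\mathbb R_+,X)$ is the space of continuous $f:\mathbb R_+\to X$ vanishing at infinity with $f(0)=0$, with the sup norm. An evolution family on $X$ is a family $\{U(t,\tau)\}_{t\ge\tau\ge0}$ of bounded linear operators on $X$ such that $U(t,\tau)=U(t,s)U(s,\tau)$ and $U(t,t)=I$ for $t\ge s\ge\tau$, and for each $x\in X$ the map $(t,\tau)\mapsto U(t,\tau)x$ is continuous for $t\ge\tau$. It is exponentially bounded if there are $M\ge1$, $\omega\in\mathbb R$ with $\|U(t,\tau)\|\le Me^{\omega(t-\tau)}$ for all $t\ge\tau$; it is (uniformly) exponentially stable if this holds with some $\omega<0$. The induced evolution semigroup on $\mathcal F$ is the strongly continuous semigroup $(E^tf)(\tau)=U(\tau,\tau-t)f(\tau-t)$ for $0\le t\le\tau$ and $(E^tf)(\tau)=0$ for $0\le\tau<t$. The growth bound of a strongly continuous semigroup $\{T^t\}_{t\ge0}$ is $\omega_0(T^t)=\inf\{\omega\in\mathbb R:\ \|T^t\|\le Me^{t\omega}\text{ for some }M\ge0\text{ and all }t\ge0\}$.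 *)

(* Defs.v *)
From mathcomp Require Import all_boot all_order all_algebra.
From mathcomp Require Import all_classical all_reals all_analysis.
From mathcomp Require Import complex.

Set Implicit Arguments.
Unset Strict Implicit.
Unset Printing Implicit Defensive.

Import Order.TTheory GRing.Theory Num.Theory.
Import numFieldNormedType.Exports.

Local Open Scope classical_set_scope.
Local Open Scope ring_scope.

(* The half-line [0, +oo[.  A function on the half-line with values in X is
   represented by a function R -> X of which only the values on the half-line
   are ever used. *)
Definition half_line (R : realType) : set R := [set t | 0 <= t].
Arguments half_line : clear implicits.

(* Over the scalars R[i] the library norm takes its values in R[i]; they are
   nonnegative reals, so nothing is lost by keeping the real part. *)
Definition rnorm (R : realType) (X : normedModType R[i]) (x : X) : R :=
  complex.Re `|x|.

(* The norm sup {N (T v) | v in D, N v <= 1} of a linear operator T on the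
   space D with norm N.  It is +oo when T is unbounded. *)
Definition op_norm (R : realType) (V : Type) (D : set V) (N : V -> \bar R)
    (T : V -> V) : \bar R :=
  ereal_sup [set N (T v) | v in [set v | D v /\ (N v <= 1)%E]].

Definition bop_norm (R : realType) (X : normedModType R[i]) (T : X -> X) :
    \bar R :=
  op_norm [set: X] (fun x => (rnorm x)%:E) T.

(* Only the operators U t tau with 0 <= tau <= t are meaningful. *)
Record evolution_family (R : realType) (X : normedModType R[i])
    (U : R -> R -> {linear X -> X}) : Prop := EvolutionFamily {
  evol_bounded : forall t tau : R, 0 <= tau -> tau <= t ->
    (bop_norm (U t tau) < +oo)%E ;
  evol_comp : forall t s tau : R, 0 <= tau -> tau <= s -> s <= t ->
    forall x, U t tau x = U t s (U s tau x) ;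
  evol_id : forall t : R, 0 <= t -> forall x, U t t x = x ;
  evol_continuous : forall x : X,
    {within [set p : R * R | 0 <= p.2 /\ p.2 <= p.1],
      continuous (fun p : R * R => U p.1 p.2 x)} }.

Definition exp_bound (R : realType) (X : normedModType R[i])
    (U : R -> R -> {linear X -> X}) (M omega : R) : Prop :=
  forall t tau : R, 0 <= tau -> tau <= t ->
    (bop_norm (U t tau) <= (M * expR (omega * (t - tau)))%:E)%E.

Definition exponentially_bounded (R : realType) (X : normedModType R[i])
    (U : R -> R -> {linear X -> X}) : Prop :=
  exists M omega : R, 1 <= M /\ exp_bound U M omega.

Definition exponentially_stable (R : realType) (X : normedModType R[i])
    (U : R -> R -> {linear X -> X}) : Prop :=
  exists M omega : R, [/\ 1 <= M, omega < 0 & exp_bound U M omega].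

Record function_space (R : realType) (X : normedModType R[i]) :=
  FunctionSpace {
    fs_mem : set (R -> X) ;
    fs_norm : (R -> X) -> \bar R }.
Arguments fs_mem {R X} _ _.
Arguments fs_norm {R X} _ _.

Definition C00_space (R : realType) (X : normedModType R[i]) :
    function_space X :=
  {| fs_mem := [set f : R -> X |
       [/\ {within half_line R, continuous f},
           f 0 = 0 & f t @[t --> +oo] --> (0 : X)]] ;
     fs_norm := fun f : R -> X =>
       ereal_sup [set (rnorm (f t))%:E | t in half_line R] |}.
Arguments C00_space : clear implicits.

Definition simple_on (R : realType) (X : normedModType R[i]) (D : set R)
    (s : R -> X) : Prop :=
  finite_set (s @` D) /\ forall x, measurable (D `&` s @^-1` [set x]).

Definition strongly_measurable_on (R : realType) (X : normedModType R[i])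
    (D : set R) (f : R -> X) : Prop :=
  exists s : nat -> R -> X, (forall n, simple_on D (s n)) /\
    forall t, D t -> s n t @[n --> \oo] --> f t.

(* Elements of L^p are represented by functions instead of a.e. classes, so
   the norm below is a seminorm depending only on the class; the norm of an
   operator that respects a.e. equality is the same on classes and on
   representatives.  Measurability is with respect to the Borel sets: every
   class of Lebesgue strongly measurable functions has a representative which
   is the everywhere limit of Borel simple functions. *)
Definition Lp_space (R : realType) (X : normedModType R[i]) (p : R) :
    function_space X :=
  let N (f : R -> X) : \bar R :=
    Lnorm (@lebesgue_measure R) p%:E
      ((fun t => (rnorm (f t))%:E) \_ (half_line R)) in
  {| fs_mem := [set f : R -> X |
       strongly_measurable_on (half_line R) f /\ (N f < +oo)%E] ;
     fs_norm := N |}.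
Arguments Lp_space : clear implicits.

Definition evolution_semigroup (R : realType) (X : normedModType R[i])
    (U : R -> R -> {linear X -> X}) (t : R) (f : R -> X) : R -> X :=
  fun tau => if t <= tau then U tau (tau - t) (f (tau - t)) else 0.

(* The infimum is taken in the extended reals: it can be -oo. *)
Definition growth_bound (R : realType) (X : normedModType R[i])
    (F : function_space X) (T : R -> (R -> X) -> (R -> X)) : \bar R :=
  ereal_inf [set omega%:E | omega in [set omega : R |
    exists M : R, 0 <= M /\ forall t : R, 0 <= t ->
      (op_norm (fs_mem F) (fs_norm F) (T t)
        <= (M * expR (t * omega))%:E)%E]].

(* Main.v *)
(* If |U(t,tau)| <= M e^{omega (t - tau)}, then pointwise
   |(E^t f)(s)| <= M e^{omega t} |f(s - t)| for s >= t, and the norm of either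
   space is monotone and does not increase under translation to the right.
   Conversely, let |x| <= 1 and c < |U(tau + t, tau) x|.  By strong continuity
   c < |U(r + t, r) x| for all r in some [tau, tau + d].  Test E^t on
   f = phi x, where phi is a bump of height 1 at tau + d for C_00, and
   d^{-1/p} times the indicator function of [tau, tau + d] for L^p: since
   (E^t f)(r + t) = phi(r) U(r + t, r) x, one gets c <= |E^t f| <= |E^t|, whence
   |U(tau + t, tau)| <= |E^t|. *)
Require Import Defs.
From mathcomp Require Import all_boot all_order all_algebra.
From mathcomp Require Import all_classical all_reals all_analysis.
From mathcomp Require Import measurable_realfun complex.
Import Order.TTheory GRing.Theory Num.Theory.
Import numFieldNormedType.Exports.
Local Open Scope complex_scope.
Local Open Scope classical_set_scope.
Local Open Scope ring_scope.

(** * Real-valued norm and real scaling on a complex normed space *)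

Section rnorm.
Context {R : realType} {X : normedModType R[i]}.
Implicit Types x y : X.

Lemma rnormE x : `|x| = (rnorm x)%:C.
Proof. by rewrite /rnorm RRe_real// ger0_real. Qed.

Lemma rnorm_ge0 x : 0 <= rnorm x.
Proof. by rewrite -lecR -rnormE normr_ge0. Qed.

Lemma rnorm0 : rnorm (0 : X) = 0.
Proof. by rewrite /rnorm normr0. Qed.

Lemma rnorm0_eq0 x : rnorm x = 0 -> x = 0.
Proof. by move=> x0; apply/normr0_eq0; rewrite rnormE x0. Qed.

Lemma normc_real (a : R) : `|a%:C| = `|a|%:C :> R[i].
Proof. by rewrite normc_def/= expr0n/= addr0 sqrtr_sqr. Qed.

Lemma rnormZ (a : R) x : rnorm (a%:C *: x) = `|a| * rnorm x.
Proof. by apply: complexI; rewrite -rnormE normrZ normc_real rnormE -rmorphM. Qed.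

Lemma ler_dist_rnorm x y : `|rnorm x - rnorm y| <= rnorm (x - y).
Proof.
by rewrite -lecR -normc_real rmorphB/= -!rnormE; exact: ler_dist_dist.
Qed.

Lemma continuous_rnorm : continuous (@rnorm R X).
Proof.
move=> x; apply/cvgrPdist_lt => e e0.
have : \forall y \near x, `|x - y| < e%:C.
  by apply: (@cvgr_dist_lt _ _ _ (nbhs x) _ id x) => //; rewrite ltcR.
apply: filterS => y; rewrite rnormE ltcR.
exact/le_lt_trans/ler_dist_rnorm.
Qed.

Lemma continuous_scale_rnorm x : continuous (fun a : R => a%:C *: x).
Proof.
move=> a; apply/cvgrPdist_lt => e e0.
have e0' : 0 < complex.Re e by move: e0; rewrite ltcE => /andP[].
have eE : e = (complex.Re e)%:C by rewrite RRe_real// gtr0_real.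
(* The [+ 1] keeps the denominator positive when [x = 0]. *)
have d0 : 0 < complex.Re e / (rnorm x + 1).
  by rewrite divr_gt0// ltr_wpDl// rnorm_ge0.
have : \forall b \near a, `|a - b| < complex.Re e / (rnorm x + 1).
  by apply: (@cvgr_dist_lt _ _ _ (nbhs a) _ id a).
apply: filterS => b ab.
rewrite -scalerBl -rmorphB/= rnormE eE ltcR rnormZ.
move: ab; rewrite ltr_pdivlMr ?ltr_wpDl ?rnorm_ge0// => /(le_lt_trans _); apply.
by rewrite ler_wpM2l// lerDl.
Qed.

(** Homogeneity: the bound on the unit ball is applied to [x / |x|], the zero vector being treated
    apart. *)
Lemma rnorm_le_bop_norm (T : {linear X -> X}) (C : R) :
  (bop_norm T <= C%:E)%E -> forall x, rnorm (T x) <= C * rnorm x.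
Proof.
move=> TC x; have [x0|x0] := eqVneq (rnorm x) 0.
  by rewrite (rnorm0_eq0 _ x0) linear0 rnorm0 mulr0.
have xp : 0 < rnorm x by rewrite lt_neqAle eq_sym x0 rnorm_ge0.
have : ((rnorm (T ((rnorm x)^-1%:C *: x)))%:E <= C%:E)%E.
  apply: le_trans TC; apply: ereal_sup_ubound => /=.
  exists ((rnorm x)^-1%:C *: x) => //; split => //.
  by rewrite lee_fin rnormZ ger0_norm ?invr_ge0 ?rnorm_ge0// mulVf.
rewrite lee_fin linearZ rnormZ ger0_norm ?invr_ge0 ?rnorm_ge0//.
by rewrite mulrC ler_pdivrMr.
Qed.

Lemma bop_norm_le (T : X -> X) (C : R) :
  (forall x, rnorm x <= 1 -> rnorm (T x) <= C) -> (bop_norm T <= C%:E)%E.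
Proof.
move=> TC; apply: ge_ereal_sup => _ [x [_ x1]] <-.
by rewrite lee_fin; apply: TC; rewrite -lee_fin.
Qed.

End rnorm.

(** * Negativity of the growth bound *)

Section growth_bound.
Context {R : realType} {X : normedModType R[i]}.
Variables (F : function_space X) (T : R -> (R -> X) -> R -> X).

(** An infimum is negative exactly when some element is, so a single negative exponent is a witness;
    the operator norm is unfolded into a bound on the unit ball. *)
Lemma growth_bound_lt0 : (growth_bound F T < 0)%E <->
  exists M omega : R, [/\ 0 <= M, omega < 0 &
    forall t f, 0 <= t -> fs_mem F f -> (fs_norm F f <= 1)%E ->
      (fs_norm F (T t f) <= (M * expR (t * omega))%:E)%E].
Proof.
split=> [/ereal_inf_lt[_ [w [M [M0 MT]] <-]] w0|[M [w [M0 w0 MT]]]].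
  exists M, w; split => // t f t0 Ff f1.
  by apply: le_trans (MT _ t0); apply: ereal_sup_ubound => /=; exists f.
apply: (@le_lt_trans _ _ w%:E); last by rewrite lte_fin.
apply: ereal_inf_lbound; exists w => //; exists M; split => // t t0.
by apply: ge_ereal_sup => _ [f [Ff f1] <-]; exact: MT.
Qed.

End growth_bound.

(** * Persistence of strict lower bounds under strong continuity *)

Section evolution_lower_semicontinuity.
Context {R : realType} {X : normedModType R[i]}.
Variable U : R -> R -> {linear X -> X}.
Hypothesis hU : evolution_family U.

(** Joint strong continuity is used along the path [r |-> (r + t, r)], which stays in the domain
    [0 <= p.2 <= p.1]. *)
Lemma evolution_rnorm_gt_near (t tau c : R) (x : X) : 0 <= t -> 0 <= tau ->
  c < rnorm (U (tau + t) tau x) ->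
  exists2 d : R, 0 < d &
    forall r, tau <= r <= tau + d -> c < rnorm (U (r + t) r x).
Proof.
move=> t0 tau0 cU.
pose A := [set p : R * R | 0 <= p.2 /\ p.2 <= p.1].
have /subspace_continuousP/(_ (tau + t, tau)) := @evol_continuous _ _ _ hU x.
have At : A (tau + t, tau) by split => //=; rewrite lerDl.
move=> /(_ At) Uc.
have : \forall p \near within A (nbhs (tau + t, tau)),
    c < rnorm (U p.1 p.2 x).
  have := cvg_comp _ _ Uc (continuous_rnorm (U (tau + t) tau x)).
  by move=> /cvgr_gt; exact.
rewrite near_withinE => /nbhs_ballP[e/= e0 eP].
(* Halving fits the closed interval into the open ball. *)
exists (e / 2); first by rewrite divr_gt0.
move=> r /andP[tr re]; have rtau : `|tau - r| < e.
  rewrite distrC ger0_norm ?subr_ge0// ltrBlDl (le_lt_trans re)// ltrD2l.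
  by rewrite ltr_pdivrMr// mulr_natr mulr2n ltrDl.
apply: (eP (r + t, r)).
  by split; rewrite /ball/=// (addrC tau) (addrC r) opprD addrACA subrr add0r.
by split => /=; [exact: le_trans tr|rewrite lerDl].
Qed.

End evolution_lower_semicontinuity.

(** * Lebesgue norms: monotonicity, scaling, translation, indicators *)

Section Lnorm_real_line.
Context {R : realType}.
Local Notation mu := (@lebesgue_measure R).
Local Open Scope ereal_scope.

(* Unlike the library's [ge0_le_integral], no measurability is required. *)
Lemma ge0_le_integralT {d} {T : measurableType d}
    (nu : {measure set T -> \bar R}) (f g : T -> \bar R) :
  (forall x, 0 <= f x) -> (forall x, f x <= g x) ->
  \int[nu]_x f x <= \int[nu]_x g x.
Proof.
move=> f0 fg.
have g0 x : 0 <= g x by exact: le_trans (fg x).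
rewrite !ge0_integralTE//; apply: le_ereal_sup => _ [h hf <-].
by exists h => // x; exact: le_trans (fg x).
Qed.

(** With no measurability assumed, this applies directly to the norm of
    [evolution_semigroup U t f]. *)
Lemma ge0_le_Lnorm {d} {T : measurableType d}
    (nu : {measure set T -> \bar R}) (p : R) (f g : T -> \bar R) :
  (0 < p)%R -> (forall x, 0 <= f x) -> (forall x, f x <= g x) ->
  Lnorm nu p%:E f <= Lnorm nu p%:E g.
Proof.
move=> p0 f0 fg.
have g0 x : 0 <= g x by exact: le_trans (fg x).
rewrite unlock; apply: gt0_ler_poweR; rewrite ?invr_ge0 ?(ltW p0)//.
- by rewrite in_itv/= leey andbT; apply: integral_ge0 => x _; exact: poweR_ge0.
- by rewrite in_itv/= leey andbT; apply: integral_ge0 => x _; exact: poweR_ge0.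
apply: ge0_le_integralT => x; first exact: poweR_ge0.
rewrite !gee0_abs//; apply: gt0_ler_poweR; rewrite ?(ltW p0)//.
- by rewrite in_itv/= leey andbT.
- by rewrite in_itv/= leey andbT.
Qed.

Lemma Lnorm_scale {d} {T : measurableType d} (nu : {measure set T -> \bar R})
    (p k : R) (f : T -> \bar R) :
  (0 < p)%R -> (0 <= k)%R -> measurable_fun setT f ->
  Lnorm nu p%:E (fun x => k%:E * f x) = k%:E * Lnorm nu p%:E f.
Proof.
move=> p0 k0 mf; rewrite unlock.
under eq_integral => x _.
  rewrite abseM poweRM// gee0_abs ?lee_fin// poweR_EFin.
  over.
rewrite ge0_integralZl_EFin ?powR_ge0//.
- rewrite poweRM ?lee_fin ?powR_ge0//; last first.
    by apply: integral_ge0 => x _; exact: poweR_ge0.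
  by rewrite poweR_EFin -powRrM mulfV ?gt_eqF// powRr1.
- by move=> x _; exact: poweR_ge0.
- apply: (measurableT_comp (measurable_poweR p)) => //.
  exact: measurableT_comp.
Qed.

Lemma measurable_shift (t : R) :
  measurable_fun [set: measurableTypeR R]
    (fun x : R => (x - t)%R : measurableTypeR R).
Proof. by apply: measurable_funB; [exact: measurable_id|exact: measurable_cst]. Qed.

(** Uniqueness of Lebesgue measure: both sides agree on the intervals []a, b]], whose preimages
    under the shift are translates of the same length. *)
Lemma lebesgue_measure_shift (t : R) (A : set R) : measurable A ->
  mu A = pushforward mu (fun x : R => (x - t)%R) A.
Proof.
pose m : {measure set (measurableTypeR R) -> \bar R} :=
  measure_function_pushforward__canonical__measure_function_Measure mu (measurable_shift t).
apply: (@lebesgue_measure_unique R m) => _ [[a b] _ <-] /=.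
rewrite /m/= /pushforward.
rewrite [X in _ = mu X](_ : _ = `](a + t)%R, (b + t)%R]%classic); last first.
  by apply/seteqP; split=> x /=; rewrite !in_itv/= ltrBrDr lerBlDr.
by rewrite !lebesgue_measure_itv/= !lte_fin ltrD2r -!EFinB opprD addrACA subrr addr0.
Qed.

(** Change of variables along the shift, whose image measure is again Lebesgue measure. *)
Lemma Lnorm_shift (p t : R) (f : R -> \bar R) : measurable_fun setT f ->
  Lnorm mu p%:E (fun x => f (x - t)%R) = Lnorm mu p%:E f.
Proof.
move=> mf; rewrite unlock; congr (_ `^ _).
have mfp : measurable_fun [set: measurableTypeR R] (fun x => `|f x| `^ p).
  apply: (measurableT_comp (measurable_poweR p)) => //.
  exact: measurableT_comp.
have fp0 : {in [set: measurableTypeR R], forall x, 0 <= `|f x| `^ p}.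
  by move=> x _; exact: poweR_ge0.
have /esym := ge0_integral_pushforward (measurable_shift t) mu measurableT mfp fp0.
rewrite preimage_setT => E; apply: etrans E _.
apply: eq_measure_integral => [|mt A mA _]; first exact: measurable_shift.
exact/esym/lebesgue_measure_shift.
Qed.

Lemma Lnorm_indic (p a b c : R) : (0 < p)%R -> (a <= b)%R -> (0 <= c)%R ->
  Lnorm mu p%:E (fun x => (c * \1_`[a, b] x)%:E) = (c * (b - a) `^ p^-1)%:E.
Proof.
move=> p0 ab c0.
have mi : measurable_fun [set: R] (fun x => (\1_`[a, b] x)%:E : \bar R).
  by apply/measurable_EFinP; exact: measurable_indic.
under eq_Lnorm do rewrite EFinM.
rewrite Lnorm_scale// EFinM; congr (_ * _).
rewrite unlock; under eq_integral => x _.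
  rewrite abse_EFin poweR_EFin.
  (* Here [p > 0] matters: [0] to the power [0] would be [1]. *)
  have -> : (`|\1_`[a, b] x| `^ p = \1_`[a, b] x :> R)%R.
    rewrite indicE; case: (_ \in _); rewrite ?normr1 ?powR1//.
    by rewrite normr0 powR0// gt_eqF.
  over.
rewrite integral_indic// setIT -poweR_EFin; congr (_ `^ _).
rewrite [LHS]lebesgue_measure_itv/= lte_fin.
by case: ltgtP ab => // ->; rewrite subrr.
Qed.

End Lnorm_real_line.

(** * Simple and strongly measurable functions with values in [X] *)

Section strong_measurability.
Context {R : realType} {X : normedModType R[i]}.

(** Every preimage is a finite union of measurable level sets, so no sigma-algebra on [X] enters. *)
Lemma measurable_rnorm_simple (D : set R) (s : R -> X) :
  simple_on D s -> measurable_fun D (fun t => rnorm (s t)).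
Proof.
move=> [fs ms] _ B _.
rewrite (_ : _ `&` _ =
    \bigcup_(x in s @` D `&` [set x | B (rnorm x)]) (D `&` s @^-1` [set x])).
  by apply: fin_bigcup_measurable => [|x _]; [exact: finite_setIl|exact: ms].
apply/seteqP; split => [t [Dt Bt]|t [x [_ Bx] [Dt sx]]] /=; last by rewrite -sx in Bx.
by exists (s t) => //; split => //; exists t.
Qed.

Lemma strongly_measurable_rnorm (D : set R) (f : R -> X) :
  strongly_measurable_on D f -> measurable_fun D (fun t => rnorm (f t)).
Proof.
move=> [s [ss sf]].
apply: (measurable_fun_cvg (fun n => measurable_rnorm_simple _ _ (ss n))) => t Dt.
exact: continuous_cvg (continuous_rnorm _) (sf t Dt).
Qed.

Lemma measurable_half_line : measurable (half_line R).
Proof.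
rewrite (_ : half_line R = `[0, +oo[%classic) //.
by apply/seteqP; split => x /=; rewrite in_itv/= andbT.
Qed.

Lemma simple_on_indic (A : set R) (D : set R) (x : X) :
  measurable D -> measurable A -> simple_on D (fun t => (\1_A t : R)%:C *: x).
Proof.
move=> mD mA; split.
  apply: (@sub_finite_set _ _ [set 0; x]); last exact: finite_set2.
  move=> _ [t _ <-]; rewrite indicE; case: (t \in A).
    by right; rewrite /= scale1r.
  by left; rewrite /= scale0r.
move=> y; apply: measurableI => //.
(* Only the values [x] and [0] are taken; for [x = 0] the level set at [0] receives both [A] and its
   complement. *)
rewrite (_ : _ @^-1` _ =
  (if `[<x = y>] then A else set0) `|` (if `[<0 = y>] then ~` A else set0)).
  by apply: measurableU; case: ifP => // _; exact: measurableC.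
apply/seteqP; split => t /=.
- rewrite indicE; case: (boolP (t \in A)).
    by rewrite inE scale1r => At xy; left; rewrite asboolT.
  by rewrite notin_setE scale0r => At xy; right; rewrite asboolT.
- by case; case: asboolP => // <- At; rewrite indicE;
    [rewrite mem_set// scale1r|rewrite memNset// scale0r].
Qed.

End strong_measurability.

(** * From a bound on the family to the same bound on the semigroup *)

Section stable_implies_decay.
Context {R : realType} {X : normedModType R[i]}.
Variables (U : R -> R -> {linear X -> X}) (M omega : R).
Hypotheses (M0 : 0 <= M) (UM : exp_bound U M omega).

Lemma rnorm_evolution_semigroup_le (t s : R) (f : R -> X) : 0 <= t ->
  rnorm (evolution_semigroup U t f s) <=
    if t <= s then M * expR (t * omega) * rnorm (f (s - t)) else 0.
Proof.
move=> t0; rewrite /evolution_semigroup; case: ifPn => ts; last by rewrite rnorm0.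
have s0 : 0 <= s - t by rewrite subr_ge0.
have ss : s - t <= s by rewrite gerBl.
by have /rnorm_le_bop_norm := UM _ _ s0 ss; rewrite subKr (mulrC omega); apply.
Qed.

Lemma C00_evolution_semigroup_le (t : R) (f : R -> X) : 0 <= t ->
  (fs_norm (C00_space R X) f <= 1)%E ->
  (fs_norm (C00_space R X) (evolution_semigroup U t f) <=
    (M * expR (t * omega))%:E)%E.
Proof.
move=> t0 f1; apply: ge_ereal_sup => _ [s s0 <-]; rewrite lee_fin.
have K0 : 0 <= M * expR (t * omega) by rewrite mulr_ge0 ?expR_ge0.
apply: (le_trans (rnorm_evolution_semigroup_le _ _ _ t0)).
case: ifPn => // ts; apply: ler_piMr => //.
rewrite -lee_fin; apply: le_trans f1; apply: ereal_sup_ubound.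
by exists (s - t) => //; rewrite /half_line/= subr_ge0.
Qed.

Lemma Lp_evolution_semigroup_le (p t : R) (f : R -> X) : 1 <= p -> 0 <= t ->
  fs_mem (Lp_space R X p) f -> (fs_norm (Lp_space R X p) f <= 1)%E ->
  (fs_norm (Lp_space R X p) (evolution_semigroup U t f) <=
    (M * expR (t * omega))%:E)%E.
Proof.
move=> p1 t0 [mf _] f1; have p0 : 0 < p by exact: lt_le_trans p1.
have K0 : 0 <= M * expR (t * omega) by rewrite mulr_ge0 ?expR_ge0.
set K := M * _ in K0 *.
(* [g] is the norm of [f] extended by zero, so that translation takes place on the whole line. *)
rewrite /= in f1 *; set g := _ \_ _ in f1.
have mg : measurable_fun setT g.
  apply/(measurable_restrictT _ measurable_half_line)/measurable_EFinP.
  exact: strongly_measurable_rnorm.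
have g0 x : (0 <= g x)%E by apply: erestrict_ge0 => y _; rewrite lee_fin rnorm_ge0.
have mgt : measurable_fun [set: measurableTypeR R] (fun x : R => g (x - t)).
  exact: (measurableT_comp mg (measurable_shift t)).
(* The dominating function vanishes for [x < t], as the evolution semigroup does. *)
apply: (@le_trans _ _ (Lnorm lebesgue_measure p%:E (fun x : R => K%:E * g (x - t)%R)%E)).
  apply: ge0_le_Lnorm => // [x|x].
    by apply: erestrict_ge0 => y _; rewrite lee_fin rnorm_ge0.
  rewrite patchE; case: ifPn => [_|_]; last by rewrite mule_ge0.
  have := rnorm_evolution_semigroup_le t x f t0; rewrite -lee_fin => /le_trans; apply.
  case: ifPn => tx; last by rewrite mule_ge0.
  by rewrite /g patchE mem_set /half_line/= ?subr_ge0// EFinM.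
rewrite (Lnorm_scale _ _ _ _ p0 K0 mgt) (Lnorm_shift _ _ _ mg) -[leRHS]mule1; exact: lee_wpmul2l.
Qed.

End stable_implies_decay.

(** * Test functions bounding the semigroup from below *)

Section test_functions.
Context {R : realType} {X : normedModType R[i]}.
Variables (U : R -> R -> {linear X -> X}) (t tau c d : R) (x : X).
Hypotheses (t0 : 0 <= t) (tau0 : 0 <= tau) (c0 : 0 <= c) (d0 : 0 < d).
Hypotheses (x1 : rnorm x <= 1).
Hypothesis Uc : forall r, tau <= r <= tau + d -> c < rnorm (U (r + t) r x).

Lemma C00_test_function : exists f : R -> X,
  [/\ fs_mem (C00_space R X) f, (fs_norm (C00_space R X) f <= 1)%E &
    (c%:E <= fs_norm (C00_space R X) (evolution_semigroup U t f))%E].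
Proof.
(* The tent of half-width [d] peaks at [tau + d] rather than [tau], so it vanishes at [0] even if
   [tau = 0]. *)
pose r := tau + d.
pose phi (s : R) := Num.max 0 (1 - `|s - r| / d).
have phi_far s : d <= `|s - r| -> phi s = 0.
  by move=> ds; apply/max_idPl; rewrite subr_le0 ler_pdivlMr// mul1r.
have phi_cont : continuous phi.
  move=> s; apply: (@continuous_max R R (cst 0) (fun s => 1 - `|s - r| / d)).
    exact: cvg_cst.
  apply: cvgB; first exact: cvg_cst.
  by apply: cvgMr_tmp; apply: cvg_norm; apply: cvgB; [exact: cvg_id|exact: cvg_cst].
have phi0 s : 0 <= phi s by rewrite le_max lexx.
have phi1 s : phi s <= 1.
  by rewrite ge_max ler01 gerBl divr_ge0// ltW.
exists (fun s => (phi s)%:C *: x); split => /=.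
- split.
  + apply: continuous_subspaceT => s.
    exact: continuous_comp (phi_cont s) (continuous_scale_rnorm x (phi s)).
  + rewrite phi_far ?scale0r// sub0r normrN ger0_norm ?addr_ge0 ?(ltW d0)//.
    by rewrite lerDr.
  + apply: cvg_near_cst; near=> s; rewrite phi_far ?scale0r//.
    rewrite (le_trans _ (ler_norm _))// lerBrDr.
    by near: s; apply: nbhs_pinfty_ge; rewrite num_real.
- apply: ge_ereal_sup => _ [s _ <-]; rewrite lee_fin rnormZ ger0_norm//.
  by rewrite mulr_ile1 ?rnorm_ge0.
(* The supremum is bounded below by its value at [r + t], where the bump contributes the factor
   [1]. *)
- apply: (@le_trans _ _ (rnorm (U (r + t) r x))%:E).
    by rewrite lee_fin ltW// Uc// lexx andbT lerDl ltW.
  apply: ereal_sup_ubound; exists (r + t) => /=.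
    by rewrite /half_line/= !addr_ge0// ltW.
  rewrite /evolution_semigroup lerDr addr_ge0 ?(ltW d0)// addrK.
  by rewrite /phi subrr normr0 mul0r subr0 (max_idPr _)// scale1r.
Unshelve. all: by end_near. Qed.

Lemma Lp_test_function (p : R) : 1 <= p -> exists f : R -> X,
  [/\ fs_mem (Lp_space R X p) f, (fs_norm (Lp_space R X p) f <= 1)%E &
    (c%:E <= fs_norm (Lp_space R X p) (evolution_semigroup U t f))%E].
Proof.
move=> p1; have p0 : 0 < p by exact: lt_le_trans p1.
(* The [L^p] norm of the indicator of an interval of length [d]; dividing by it puts [f] in the unit
   ball. *)
pose a := d `^ p^-1.
have a0 : 0 < a by exact: powR_gt0.
pose y := a^-1%:C *: x.
pose f s := (\1_`[tau, tau + d] s : R)%:C *: y.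
have f1 : (fs_norm (Lp_space R X p) f <= 1)%E.
  rewrite /=; apply: (@le_trans _ _ (Lnorm lebesgue_measure p%:E
      (fun s => (a^-1 * \1_`[tau, tau + d] s)%:E))).
    apply: ge0_le_Lnorm => // s.
      by apply: erestrict_ge0 => ? _; rewrite lee_fin rnorm_ge0.
    rewrite patchE; case: ifPn => _; rewrite lee_fin; last first.
      by rewrite mulr_ge0 ?invr_ge0 ?(ltW a0)// indicE.
    rewrite !rnormZ ger0_norm ?indicE// ger0_norm ?invr_ge0 ?(ltW a0)// mulrC.
    by rewrite ler_wpM2r// ler_piMr// invr_ge0 ltW.
  rewrite (Lnorm_indic _ _ _ _ p0) ?invr_ge0 ?(ltW a0)// ?lerDl ?(ltW d0)//.
  by rewrite addrC addKr mulVf ?gt_eqF.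
exists f; split => //.
- split; last by rewrite (le_lt_trans f1)// ltry.
  (* [f] is itself simple, so the constant sequence approximates it. *)
  exists (fun=> f); split => [_|s _]; last exact: cvg_cst.
  by apply: simple_on_indic => //; exact: measurable_half_line.
(* On the interval translated by [t] the image has norm above [c / a]; this minorant has [L^p] norm
   [c / a * a = c]. *)
- apply: (@le_trans _ _ (Lnorm lebesgue_measure p%:E
      (fun s => (c / a * \1_`[tau + t, tau + t + d] s)%:E))).
    rewrite (Lnorm_indic _ _ _ _ p0) ?divr_ge0 ?(ltW a0)// ?lerDl ?(ltW d0)//.
    by rewrite (addrC _ d) addrK divfK ?gt_eqF.
  apply: ge0_le_Lnorm => // s.
    by rewrite lee_fin mulr_ge0 ?divr_ge0 ?(ltW a0)// indicE.
  rewrite indicE; case: (boolP (s \in _)); last first.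
    by move=> _; rewrite mulr0; apply: erestrict_ge0 => ? _; rewrite lee_fin rnorm_ge0.
  rewrite inE/= in_itv/= => /andP[s1 s2].
  have ts : t <= s by rewrite (le_trans _ s1)// lerDr.
  rewrite patchE mem_set; last by rewrite /half_line/= (le_trans t0).
  rewrite /evolution_semigroup ts /f indicE mem_set; last first.
    by rewrite /= in_itv/= lerBrDr s1 lerBlDr addrAC.
  rewrite scale1r linearZ rnormZ gtr0_norm ?invr_gt0// lee_fin mulr1 mulrC.
  rewrite ler_pM2l ?invr_gt0// ltW//.
  have := Uc (s - t); rewrite subrK; apply.
  by rewrite lerBrDr s1 lerBlDr addrAC.
Qed.

End test_functions.

Theorem theorem3p2 (R : realType) (X : completeNormedModType R[i])
    (F : function_space X)
    (hF : F = C00_space R X \/ exists p : R, 1 <= p /\ F = Lp_space R X p)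
    (U : R -> R -> {linear X -> X})
    (hU : evolution_family U) (hb : exponentially_bounded U) :
  exponentially_stable U <->
    (growth_bound F (evolution_semigroup U) < 0)%E.
Proof.
rewrite growth_bound_lt0; split=> [[M [w [M1 w0 UM]]]|[M [w [M0 w0 TM]]]].
  have M0 : 0 <= M by exact: le_trans M1.
  exists M, w; split => // t f t0 Ff f1.
  case: hF Ff f1 => [->|[p [p1 ->]]] Ff f1.
    exact: C00_evolution_semigroup_le.
  exact: Lp_evolution_semigroup_le.
(* Stability asks for a constant at least [1], while the growth bound only yields [0 <= M]. *)
exists (Num.max M 1), w; split; rewrite ?le_max ?lexx ?orbT// => t tau tau0 taut.
apply: bop_norm_le => x x1.
have t0 : 0 <= t - tau by rewrite subr_ge0.
apply: (@le_trans _ _ (M * expR ((t - tau) * w))); last first.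
  by rewrite mulrC [w * _]mulrC [leRHS]mulrC ler_wpM2l ?expR_ge0// le_max lexx.
set K := M * _; have K0 : 0 <= K by rewrite mulr_ge0 ?expR_ge0.
rewrite leNgt; apply/negP => KU.
(* The midpoint leaves strict room on both sides: below the norm, for persistence to the right of
   [tau], and above [K], for the final contradiction. *)
pose c := (K + rnorm (U t tau x)) / 2.
have Kc : K < c by rewrite /c midf_lt.
have cU : c < rnorm (U (tau + (t - tau)) tau x).
  by rewrite addrC subrK /c midf_lt.
have [d d0 Uc] := evolution_rnorm_gt_near _ hU _ _ _ _ t0 tau0 cU.
have c0 : 0 <= c by exact: le_trans (ltW Kc).
have [f [Ff f1 cf]] : exists f : R -> X, [/\ fs_mem F f, (fs_norm F f <= 1)%E &
    (c%:E <= fs_norm F (evolution_semigroup U (t - tau) f))%E].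
  case: hF => [->|[p [p1 ->]]]; first exact: (C00_test_function _ _ tau _ d x).
  exact: (Lp_test_function _ _ tau _ d x).
by have := le_trans cf (TM _ _ t0 Ff f1); rewrite lee_fin leNgt Kc.
Qed.
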